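(* Let $(X,d)$ be a metric space with $|X|\geq 3$ (not assumed complete), let $x^*\in X$, and let $T\colon X\to X$ be a mapping satisfying the following four conditions: (i) $T$ does not possess periodic points of prime period $2$; (ii) $T$ is a generalized Kannan type mapping on $X$; (iii) $T$ is continuous at $x^*$; (iv) there exists a point $x_0\in X$ such that the sequence of iterates $x_n=Tx_{n-1}$, $n=1,2,\ldots$, has a subsequence $x_{n_k}$ converging to $x^*$. Then $x^*$ is a fixed point of $T$, and the number of fixed points of $T$ is at most two.
   Context: For a metric space $(X,d)$ with $|X|\geq 3$, a mapping $T\colon X\to X$ is called a generalized Kannan type mapping on $X$ if there exists $\lambda\in[0,\frac{2}{3})$ such that the inequality $$d(Tx,Ty)+d(Ty,Tz)+d(Tx,Tz)\leq \lambda\,(d(x,Tx)+d(y,Ty)+d(z,Tz))$$ holds for all three pairwise distinct points $x,y,z\in X$. A point $x\in X$ is a periodic point of prime period $2$ of $T$ if $T(T(x))=x$ and $Tx\neq x$. *)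

(* Defs.v *)
From HB Require Import structures.
From mathcomp Require Import all_boot all_order all_algebra.
From mathcomp Require Import all_classical all_reals topology sequences.

Set Implicit Arguments.
Unset Strict Implicit.
Unset Printing Implicit Defensive.

Import Order.TTheory GRing.Theory Num.Theory.

Local Open Scope classical_set_scope.
Local Open Scope ring_scope.

Definition generalized_kannan (R : realType) (X : metricType R)
    (T : X -> X) : Prop :=
  exists lambda : R, (0 <= lambda < 2 / 3) /\
    forall x y z : X, x <> y -> y <> z -> x <> z ->
      mdist (T x) (T y) + mdist (T y) (T z) + mdist (T x) (T z)
        <= lambda * (mdist x (T x) + mdist y (T y) + mdist z (T z)).

Definition periodic2 (X : Type) (T : X -> X) (x : X) : Prop :=
  T (T x) = x /\ T x <> x.

Definition fixed_points (X : Type) (T : X -> X) : set X := [set x | T x = x].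

(* Main.v *)
Require Import Defs.
From HB Require Import structures.
From mathcomp Require Import all_boot all_order all_algebra.
From mathcomp Require Import all_classical all_reals topology sequences.
From mathcomp Require Import normedtype lra.

(** Write [d n] for the displacement [mdist (x n) (T (x n))] along an orbit.
    The Kannan inequality at three consecutive points of the orbit, combined
    with the triangle inequality, bounds [d n.+2] by a factor [q < 1] times
    the mean of [d n] and [d n.+1] ([displacement_recurrence]).  The absence
    of points of prime period 2 enters here: it makes any three consecutive
    points of an orbit that has not reached a fixed point pairwise distinct,
    while after a fixed point the displacements vanish.  Such a recurrence
    forces geometric decay ([mean_contraction_cvg0]),
    so [T] moves the points of the orbit less and less.  Along a subsequence
    converging to [xstar], continuity of [T] at [xstar] passes this to the
    limit, and [xstar] is not moved at all ([cvg_displacement0_fixed]).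
    Completeness of the space is replaced by the given limit point.

    At three distinct fixed points the right-hand side of the Kannan inequality
    vanishes while the left-hand side is positive; hence there are at most two
    fixed points. *)

Set Implicit Arguments.
Unset Strict Implicit.
Unset Printing Implicit Defensive.

Import Order.TTheory GRing.Theory Num.Theory.
Import numFieldNormedType.Exports.

Local Open Scope classical_set_scope.
Local Open Scope ring_scope.
Local Open Scope card_scope.

Lemma card_le_I2 (X : Type) (A : set X) :
  (forall x y z, A x -> A y -> A z -> x <> y -> y <> z -> x = z) ->
  A #<= `I_2.
Proof.
move=> A3; have [->|/set0P[a Aa]] := eqVneq A set0; first exact: card_ge0.
have [[b [Ab ab]]|noB] := pselect (exists b, A b /\ a <> b); last first.
  apply: (card_le_trans _ (card_image_le (fun=> a) `I_2)).
  apply: subset_card_le => x Ax; exists 0%N => //=.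
  by apply: contrapT => ax; apply: noB; exists x.
pose f i := if i is 0%N then a else b.
apply: (card_le_trans _ (card_image_le f `I_2)).
apply: subset_card_le => x Ax.
have [<-|bx] := pselect (b = x); first by exists 1%N.
by exists 0%N => //=; apply: A3 ab bx.
Qed.

Lemma increasing_seq_cvg_infty (f : nat -> nat) :
  increasing_seq f -> f @ \oo --> \oo.
Proof.
move=> f_incr.
have le_f n : (n <= f n)%N.
  elim: n => // n IHn; apply: leq_ltn_trans IHn _.
  by rewrite ltnNge -[(_ <= _)%N]/(f n.+1 <= f n)%O f_incr -ltnNge.
move=> A [N _ NA]; exists N => // n /= Nn.
by apply: NA => /=; apply: leq_trans (le_f n).
Qed.

(** A term may exceed its predecessor, so [u] cannot be compared term to term
    with [q * u].  A geometric majorant [K * r ^+ n]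
    propagates through the recurrence as soon as [q * (1 + r) / 2 <= r ^+ 2];
    the choice [r = (1 + q) / 2] works because [q <= r ^+ 2]. *)
Lemma mean_contraction_cvg0 (R : realType) (q : R) (u : nat -> R) :
  0 <= q < 1 -> (forall n, 0 <= u n) ->
  (forall n, u n.+2 <= q * ((u n + u n.+1) / 2)) ->
  u @ \oo --> (0 : R).
Proof.
move=> /andP[q0 q1] u0 u_rec.
pose r := (1 + q) / 2.
have r12 : 1 / 2 <= r by rewrite /r; lra.
have r1 : r < 1 by rewrite /r; lra.
have qr : q <= r ^+ 2 by rewrite /r; have := sqr_ge0 (1 - q); nra.
(* [K] dominates [u 0], and [K * r] dominates [u 1] because [r >= 1 / 2] *)
pose K := u 0%N + 2 * u 1%N.
have K0 : 0 <= K by have := u0 0%N; have := u0 1%N; rewrite /K; lra.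
have u_le n : u n <= K * r ^+ n.
  suff : u n <= K * r ^+ n /\ u n.+1 <= K * r ^+ n.+1 by case.
  elim: n => [|n [IH0 IH1]].
    have := u0 0%N; have := u0 1%N.
    by rewrite expr0 expr1 /K; split; nra.
  split=> //; apply: le_trans (u_rec n) _.
  have Krn0 : 0 <= K * r ^+ n by rewrite mulr_ge0// exprn_ge0//; lra.
  move: IH1; rewrite exprS mulrCA => IH1.
  rewrite [leRHS](_ : _ = r ^+ 2 * (K * r ^+ n)); last first.
    by rewrite [RHS]mulrCA -exprD.
  apply: (@le_trans _ _ (q * (K * r ^+ n))); last exact: ler_wpM2r.
  by apply: ler_wpM2l => //; nra.
apply: (@squeeze_cvgr _ _ _ _ (cst 0) (geometric K r)).
- by apply: nearW => n; rewrite u0/= u_le.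
- exact: cvg_cst.
- by apply: cvg_geometric; rewrite ger0_norm//; lra.
Qed.

(** A limit point of a sequence that [T] displaces less and less is fixed: in
    [mdist p (T p) <= mdist p (y n) + mdist (y n) (T (y n)) + mdist (T (y n)) (T p)]
    all three terms on the right are eventually small. *)
Lemma cvg_displacement0_fixed (R : realType) (X : metricType R) (T : X -> X)
    (y : nat -> X) (p : X) :
  continuous_at p T -> y @ \oo --> p ->
  (fun n => mdist (y n) (T (y n))) @ \oo --> (0 : R) -> T p = p.
Proof.
move=> T_cont yp dy0.
have Typ : (T \o y) @ \oo --> T p by apply: cvg_comp yp T_cont.
apply/esym/mdist_positivity/eqP; rewrite eq_le mdist_ge0 andbT.
apply/ler_addgt0Pr => e e0; rewrite add0r.
have e30 : 0 < e / 3 by lra.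
have [n []] : exists n, [/\ mdist p (y n) < e / 3,
    mdist (T p) (T (y n)) < e / 3 & mdist (y n) (T (y n)) < e / 3].
  near \oo => n; exists n; split; near: n.
  - exact: metricType_numDomainType.cvgr_dist_lt yp _ e30.
  - exact: metricType_numDomainType.cvgr_dist_lt Typ _ e30.
  - move/cvgr0Pnorm_lt : dy0 => /(_ _ e30); apply: filterS => k.
    by apply: le_lt_trans; exact: ler_norm.
have := metric_triangle p (y n) (T p).
have := metric_triangle (y n) (T (y n)) (T p).
rewrite (metric_sym (T (y n))); lra.
Unshelve. all: by end_near.
Qed.

(** With [a], [b], [c] the displacements of [x], [T x], [T (T x)], the Kannan
    inequality at these points and [c <= b + mdist (T x) (T (T (T x)))] give
    [2 * c <= l * (a + b + c)]; since [l <= 2 / 3], solving for [c] gives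
    [c <= (3 / 2) * l * ((a + b) / 2)], where [(3 / 2) * l < 1]. *)
Lemma displacement_recurrence (R : realType) (X : metricType R) (T : X -> X) :
  (forall x, ~ periodic2 T x) -> generalized_kannan T ->
  exists2 q : R, 0 <= q < 1 & forall x,
    mdist (T (T x)) (T (T (T x))) <=
      q * ((mdist x (T x) + mdist (T x) (T (T x))) / 2).
Proof.
move=> no_period2 [l [/andP[l0 l23] T_kannan]].
exists (3 / 2 * l); first by apply/andP; split; lra.
move=> x.
have := mdist_ge0 x (T x); have := mdist_ge0 (T x) (T (T x)).
have [TTx a0 b0|TTx_neq] := pselect (T x = T (T x)).
  by rewrite -!TTx mdistxx; nra.
have Tx_neq : x <> T x by move=> xE; apply: TTx_neq; rewrite -xE.
have TTx_neqx : x <> T (T x).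
  by move=> xE; apply: (no_period2 x); split=> // /esym.
have := T_kannan _ _ _ Tx_neq TTx_neq TTx_neqx.
have := metric_triangle (T (T x)) (T x) (T (T (T x))).
rewrite (metric_sym (T (T x)) (T x)).
have := mdist_ge0 (T (T x)) (T (T (T x))).
set a := mdist x _; set b := mdist (T x) (T (T x)).
set c := mdist (T (T x)) _; set e := mdist (T x) _.
move=> c0 tri kan b0 a0.
have : 2 * c <= l * (a + b + c) by nra.
have : l * c <= 2 / 3 * c by apply: ler_wpM2r => //; lra.
nra.
Qed.

Lemma kannan_fixed_points_card (R : realType) (X : metricType R) (T : X -> X) :
  generalized_kannan T -> fixed_points T #<= `I_2.
Proof.
move=> [l [_ T_kannan]]; apply: card_le_I2 => x y z Tx Ty Tz xy yz.
apply: contrapT => xz; have := T_kannan x y z xy yz xz.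
rewrite Tx Ty Tz !mdistxx !addr0 mulr0.
have : 0 < mdist x y by rewrite mdist_gt0; apply/eqP.
have := mdist_ge0 y z; have := mdist_ge0 x z; lra.
Qed.

Theorem theorem6p1 (R : realType) (X : metricType R)
    (card_X : `I_3 #<= [set: X]) (xstar : X) (T : X -> X)
    (no_period2 : forall x : X, ~ periodic2 T x)
    (T_kannan : generalized_kannan T)
    (T_cont : continuous_at xstar T)
    (T_subseq : exists (x0 : X) (n_ : nat -> nat),
        increasing_seq n_ /\
        (fun n : nat => iter n T x0) \o n_ @ \oo --> xstar) :
  T xstar = xstar /\ fixed_points T #<= `I_2.
Proof.
split; last exact: kannan_fixed_points_card T_kannan.
have [x0 [n_ [n_incr orbit_cvg]]] := T_subseq.
have [q q01 d_rec] := displacement_recurrence no_period2 T_kannan.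
pose d n := mdist (iter n T x0) (iter n.+1 T x0).
have d_cvg0 : d @ \oo --> (0 : R).
  apply: (mean_contraction_cvg0 q01) => n; first exact: mdist_ge0.
  exact: d_rec.
apply: (cvg_displacement0_fixed T_cont orbit_cvg).
exact: cvg_comp (increasing_seq_cvg_infty n_incr) d_cvg0.
Qed.
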